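(* The ordinary generating function $u_{231}(z)=\sum_{n\ge 0}u_n(231)z^n$ satisfies \[u_{231}(z)=\frac{1+z^2-\sqrt{1-4z+2z^2+z^4}}{2z}.\]
   Context: An increasing subsequence of a permutation $p=p_1p_2\cdots p_n$ is a set of entries $p_{j_1}<p_{j_2}<\cdots<p_{j_k}$ with $j_1<j_2<\cdots<j_k$ (positions need not be consecutive). The permutation $p$ has a unique longest increasing subsequence (ULIS) if it has an increasing subsequence that is longer than all its other increasing subsequences. A permutation $p$ contains the pattern $q=q_1\cdots q_k$ if there are indices $i_1<\cdots<i_k$ such that $p_{i_r}<p_{i_s}$ if and only if $q_r<q_s$; otherwise $p$ avoids $q$. For a pattern $q$, $u_n(q)$ denotes the number of permutations of length $n$ that avoid $q$ and have a ULIS, with the convention $u_0(q)=1$. The square root denotes the power series branch with constant term $1$. *)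

(* Defs.v *)
From HB Require Import structures.
From mathcomp Require Import all_boot all_order all_algebra all_fingroup.
From mathcomp Require Import boolp classical_sets.

Set Implicit Arguments.
Unset Strict Implicit.
Unset Printing Implicit Defensive.

Import GRing.Theory.
Local Open Scope ring_scope.

(* Formal power series, with the Cauchy product.  The record wrapper keeps    *)
(* the ring structure apart from the pointwise one on functions nat -> R.     *)
Record fps (R : Type) := Fps { fps_coef :> nat -> R }.

HB.instance Definition _ (R : Type) := gen_eqMixin (fps R).
HB.instance Definition _ (R : Type) := gen_choiceMixin (fps R).

Section FpsRing.
Variable R : comNzRingType.
Implicit Types f g h : fps R.

Lemma fpsP f g : (forall n, f n = g n) -> f = g.
Proof. by case: f; case: g => g f /= /funext ->. Qed.

Definition fps_zero : fps R := Fps (fun=> 0).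
Definition fps_one : fps R := Fps (fun n => (n == 0)%:R).
Definition fps_opp f : fps R := Fps (fun n => - f n).
Definition fps_add f g : fps R := Fps (fun n => f n + g n).
Definition fps_mul f g : fps R :=
  Fps (fun n => \sum_(k < n.+1) f k * g (n - k)%N).

Let tr n f : {poly R} := \poly_(i < n.+1) f i.

Let tr_coef n f k : (k <= n)%N -> (tr n f)`_k = f k.
Proof. by move=> le_kn; rewrite coef_poly ltnS le_kn. Qed.

Let tr_mul n f g k : (k <= n)%N -> (tr n f * tr n g)`_k = fps_mul f g k.
Proof.
move=> le_kn; rewrite coefM; apply: eq_bigr => i _.
rewrite !tr_coef //; first exact: leq_trans (leq_subr _ _) le_kn.
by apply: leq_trans le_kn; rewrite -ltnS.
Qed.

Fact fps_addA : associative fps_add.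
Proof. by move=> f g h; apply: fpsP => n; apply: addrA. Qed.
Fact fps_addC : commutative fps_add.
Proof. by move=> f g; apply: fpsP => n; apply: addrC. Qed.
Fact fps_add0 : left_id fps_zero fps_add.
Proof. by move=> f; apply: fpsP => n; apply: add0r. Qed.
Fact fps_addN : left_inverse fps_zero fps_opp fps_add.
Proof. by move=> f; apply: fpsP => n; apply: addNr. Qed.

HB.instance Definition _ :=
  GRing.isZmodule.Build (fps R) fps_addA fps_addC fps_add0 fps_addN.

Fact fps_mulA : associative fps_mul.
Proof.
move=> f g h; apply: fpsP => n.
transitivity ((tr n f * (tr n g * tr n h))`_n).
  rewrite coefM; apply: eq_bigr => i _.
  by rewrite tr_coef ?tr_mul ?leq_subr // -ltnS.
rewrite mulrA coefM; apply: eq_bigr => i _.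
by rewrite tr_coef ?tr_mul ?leq_subr // -ltnS.
Qed.

Fact fps_mulC : commutative fps_mul.
Proof. by move=> f g; apply: fpsP => n; rewrite -!(tr_mul _ _ (leqnn n)) mulrC. Qed.

Fact fps_mul1 : left_id fps_one fps_mul.
Proof.
move=> f; apply: fpsP => n /=.
by rewrite big_ord_recl mul1r subn0 big1 ?addr0 // => i _; rewrite mul0r.
Qed.

Fact fps_mulDl : left_distributive fps_mul fps_add.
Proof.
move=> f g h; apply: fpsP => n /=; rewrite -big_split.
by apply: eq_bigr => i _; rewrite mulrDl.
Qed.

Fact fps_one_neq0 : fps_one != fps_zero.
Proof.
by apply/eqP => /(congr1 (fun f : fps R => f 0%N)) /eqP; rewrite /= oner_eq0.
Qed.

HB.instance Definition _ := GRing.Zmodule_isComNzRing.Build (fps R)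
  fps_mulA fps_mulC fps_mul1 fps_mulDl fps_one_neq0.

Definition fps_unit : pred (fps R) := fun f => `[< exists g, g * f = 1 >].
Definition fps_inv f : fps R :=
  if fps_unit f then xget 0 [set g | g * f = 1]%classic else f.

Fact fps_mulVf : {in fps_unit, left_inverse 1 fps_inv *%R}.
Proof.
move=> f uf; rewrite /fps_inv (uf : fps_unit f).
by move/asboolP: (uf) => [g gf]; apply: (@xgetI _ 0 [set g | g * f = 1]%classic g gf).
Qed.

Fact fps_unitP f g : g * f = 1 -> fps_unit f.
Proof. by move=> gf; apply/asboolP; exists g. Qed.

Fact fps_inv_out : {in [predC fps_unit], fps_inv =1 id}.
Proof. by move=> f /negPf nuf; rewrite /fps_inv [fps_unit f]nuf. Qed.

HB.instance Definition _ := GRing.ComNzRing_hasMulInverse.Build (fps R)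
  fps_mulVf fps_unitP fps_inv_out.

Lemma fps_coef0 n : (0 : fps R) n = 0. Proof. by []. Qed.
Lemma fps_coef1 n : (1 : fps R) n = (n == 0)%:R. Proof. by []. Qed.
Lemma fps_coefN f n : (- f) n = - f n. Proof. by []. Qed.
Lemma fps_coefD f g n : (f + g) n = f n + g n. Proof. by []. Qed.
Lemma fps_coefM f g n : (f * g) n = \sum_(k < n.+1) f k * g (n - k)%N.
Proof. by []. Qed.

Definition fpsX : fps R := Fps (fun n => (n == 1)%:R).

End FpsRing.

Section FpsDomain.
Variable R : idomainType.

Fact fps_integral (f g : fps R) : f * g = 0 -> (f == 0) || (g == 0).
Proof.
have nz (h : fps R) : h != 0 ->
    exists2 a, h a != 0 & forall k, (k < a)%N -> h k = 0.
  move=> h0; have ex_h : exists n, h n != 0.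
    apply: contrapT => nh; case/eqP: h0; apply: fpsP => n.
    by apply: contrapT => /eqP hn; apply: nh; exists n.
  case: (ex_minnP ex_h) => a ha min_a; exists a => // k lt_ka.
  by apply/eqP; apply: contraTT lt_ka => /min_a; rewrite -leqNgt.
move=> fg0; apply/norP => -[/nz[a fa lta] /nz[b gb ltb]].
have := congr1 (fun h : fps R => h (a + b)%N) fg0.
have lt_a : (a < (a + b).+1)%N by rewrite ltnS leq_addr.
rewrite fps_coefM fps_coef0 (bigD1 (Ordinal lt_a)) //= addKn big1 ?addr0.
  by move/eqP; rewrite mulf_eq0 (negPf fa) (negPf gb).
move=> i ne_ia; case: (ltngtP i a) => [/lta->|lt_ai|eq_ia].
- by rewrite mul0r.
- rewrite [g _]ltb ?mulr0 // ltn_subLR ?ltn_add2r //; by rewrite -ltnS.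
- by case/eqP: ne_ia; apply: val_inj.
Qed.

HB.instance Definition _ :=
  GRing.ComUnitRing_isIntegral.Build (fps R) fps_integral.

End FpsDomain.

(* The branch of the square root with constant term 1; it is well defined     *)
(* when f has constant term 1 and 2 != 0, by fps_sqrtP and fps_sqrt_uniq.     *)
Definition fps_sqrt (R : idomainType) (f : fps R) : fps R :=
  xget 0 [set s : fps R | s 0%N = 1 /\ s ^+ 2 = f]%classic.

Section FpsSqrt.
Variable R : fieldType.
Hypothesis two_neq0 : 2%:R != 0 :> R.
Implicit Types f s : fps R.

Let fps_rec (F : nat -> (nat -> R) -> R) :
    (forall n b c, (forall k, (k < n)%N -> b k = c k) -> F n b = F n c) ->
  exists b : nat -> R, forall n, b n = F n b.
Proof.
move=> locF; pose G (b : nat -> R) n := F n b.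
have stab k m1 m2 : (k < m1)%N -> (k < m2)%N ->
    iter m1 G (fun=> 0) k = iter m2 G (fun=> 0) k.
  elim/ltn_ind: k m1 m2 => k IHk [//|m1] [//|m2] lt1 lt2 /=.
  by apply: locF => j lt_jk; apply: IHk => //; apply: leq_trans lt_jk _.
exists (fun n => iter n.+1 G (fun=> 0) n) => n /=.
by apply: locF => k lt_kn; apply: (stab k n k.+1).
Qed.

Lemma fps_sqrtP f : f 0%N = 1 -> fps_sqrt f 0%N = 1 /\ fps_sqrt f ^+ 2 = f.
Proof.
move=> f0; pose F n (b : nat -> R) :=
  if n is m.+1 then (f n - \sum_(k < m) b k.+1 * b (m - k)%N) / 2%:R else 1.
have [] := @fps_rec F.
  move=> [//|m] b c eq_bc /=; congr ((_ - _) / _); apply: eq_bigr => k _.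
  by rewrite !eq_bc // ltnS ?leq_subr.
move=> b bE; suff Sb : (Fps b) 0%N = 1 /\ (Fps b) ^+ 2 = f.
  exact: (@xgetI _ 0 [set s : fps R | s 0%N = 1 /\ s ^+ 2 = f]%classic _ Sb).
split=> /=; first by rewrite bE.
apply: fpsP => -[|m]; rewrite expr2 fps_coefM /=.
  by rewrite big_ord1 subn0 bE f0 mulr1.
rewrite big_ord_recl big_ord_recr /= subn0 subnn [b 0%N]bE /= mul1r mulr1.
rewrite addrCA -mulr2n -[b m.+1 *+ 2]mulr_natr [b m.+1]bE /= divfK //.
by rewrite addrCA subrr addr0.
Qed.

Lemma fps_sqrt_uniq f s : s 0%N = 1 -> s ^+ 2 = f -> fps_sqrt f = s.
Proof.
move=> s0 s2; have f0 : f 0%N = 1.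
  by rewrite -s2 expr2 fps_coefM big_ord1 subn0 s0 mulr1.
have [t0 t2] := fps_sqrtP f0; have /eqP := t2.
rewrite -{2}s2 eqf_sqr => /orP[/eqP //|/eqP tN].
by case/eqP: two_neq0; rewrite mulr2n -{1}t0 tN fps_coefN s0 addNr.
Qed.

End FpsSqrt.

(* A permutation of length n is p : 'S_n; positions and values run over       *)
(* 0, ..., n - 1 instead of 1, ..., n.                                        *)
Section Patterns.

Definition contains (n k : nat) (p : 'S_n) (q : 'S_k) : bool :=
  [exists f : {ffun 'I_k -> 'I_n},
    [forall r : 'I_k, forall s : 'I_k, (r < s)%N ==> (f r < f s)%N] &&
    [forall r : 'I_k, forall s : 'I_k, (p (f r) < p (f s))%N == (q r < q s)%N]].

Definition avoids (n k : nat) (p : 'S_n) (q : 'S_k) : bool := ~~ contains p q.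

(* A set of entries is given by the set of its positions. *)
Definition increasing (n : nat) (p : 'S_n) (A : {set 'I_n}) : bool :=
  [forall i in A, forall j in A, (i < j)%N ==> (p i < p j)%N].

Definition has_ULIS (n : nat) (p : 'S_n) : bool :=
  [exists A : {set 'I_n}, increasing p A &&
    [forall B : {set 'I_n}, increasing p B ==> (B != A) ==> (#|B| < #|A|)%N]].

Definition ulis_count (n k : nat) (q : 'S_k) : nat :=
  if n is 0 then 1%N else #|[set p : 'S_n | avoids p q && has_ULIS p]|.

Definition ulis_gf (k : nat) (q : 'S_k) : fps rat := Fps (fun n => (ulis_count n q)%:R).

Let t231 : 3.-tuple 'I_3 := [tuple inord 1; inord 2; inord 0].

Fact t231_inj : injective (tnth t231).
Proof. by apply/tuple_uniqP; rewrite /= !inE -!val_eqE /= !inordK. Qed.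

(* 231 with its values shifted down by one: 0 |-> 1, 1 |-> 2, 2 |-> 0. *)
Definition p231 : 'S_3 := perm t231_inj.

Fact p231E :
  [seq val (p231 i) | i <- [:: inord 0; inord 1; inord 2]] = [:: 1; 2; 0]%N.
Proof. by rewrite /= /p231 !permE !(tnth_nth ord0) /= !inordK //=; rewrite !inordK. Qed.

End Patterns.

(* Main.v *)
Require Import Defs.
From mathcomp Require Import all_boot all_order all_algebra all_fingroup.
From mathcomp Require Import boolp zify ring.

Set Implicit Arguments.
Unset Strict Implicit.
Unset Printing Implicit Defensive.

Import GRing.Theory.
Local Open Scope nat_scope.

(** Write a 231-avoiding permutation of 0, ..., n as L n R.  An entry of L
    exceeding an entry of R would play the role of the 2 in a pattern 231 whose
    3 is the maximum n, so all of L lies below all of R: with k = |L|, the word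
    L is a permutation of 0, ..., k - 1 and R one of k, ..., n - 1, and
    conversely every such choice of 231-avoiding L and R gives a 231-avoiding
    permutation ([good_perms_decomp]).

    An increasing subsequence of L n R is an increasing subsequence of L followed
    either by n alone or by an increasing subsequence of R, both parts being
    chosen freely.  Hence the longest one is unique exactly when it is unique in
    each of the two factors ([unique_longest_cat]).  In the second factor, n
    alone ties with a single entry of R when |R| = 1 and otherwise changes
    nothing: if R is empty, n is the only nonempty choice, and if |R| >= 2 and R
    has a unique longest increasing subsequence, that one has length at least 2,
    since two distinct entries of R would tie at length 1
    ([unique_longest_right]).

    So u(n + 1) is the sum of u(k) u(n - k) over the k <= n with n - k <> 1
    ([gcountS]).  As u(1) = 1, the generating function satisfies
    u = 1 + z u (u - z) ([ulis_gf_eq]), that is z u^2 - (1 + z^2) u + 1 = 0.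
    Completing the square, 1 + z^2 - 2 z u has constant term 1 and square
    1 - 4 z + 2 z^2 + z^4, so it is the required branch of the square root.

    The combinatorics is carried out on words, i.e. on sequences of natural
    numbers, where cutting at the maximum is concatenation; a word is allowed to
    be a permutation of any interval m, ..., m + n - 1, so that R need not be
    renumbered. *)

(** * Words: pattern avoidance and longest increasing subsequences *)

Definition avoid231 (s : seq nat) : Prop :=
  forall b c a, subseq [:: b; c; a] s -> ~~ (a < b < c).

Definition incr_sub (s t : seq nat) : Prop := subseq t s /\ sorted ltn t.

(** A property of an arbitrary family of sequences, because the second factor of
    the decomposition is not the family of increasing subsequences of a word. *)
Definition unique_longest (X : seq nat -> Prop) : Prop :=
  exists2 A, X A & forall B, X B -> B <> A -> size B < size A.

Definition good (s : seq nat) : Prop :=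
  avoid231 s /\ unique_longest (incr_sub s).

Definition good_perms (m n : nat) : seq (seq nat) :=
  [seq s <- permutations (iota m n) | `[< good s >]].

Lemma subseq_cat_split (T : eqType) (t s1 s2 : seq T) :
  subseq t (s1 ++ s2) ->
  exists t1 t2, [/\ t = t1 ++ t2, subseq t1 s1 & subseq t2 s2].
Proof.
case/subseqP=> m sz_m ->; exists (mask (take (size s1) m) s1).
exists (mask (drop (size s1) m) s2); split; try exact: mask_subseq.
by rewrite -{1}(cat_take_drop (size s1) m) mask_cat // size_takel // sz_m size_cat leq_addr.
Qed.

Lemma subseq_map_split (T T' : eqType) (g : T -> T') (t : seq T') (s : seq T) :
  subseq t (map g s) -> exists2 u, subseq u s & t = map g u.
Proof.
case/subseqP=> m sz_m ->; exists (mask m s); first exact: mask_subseq.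
by rewrite map_mask.
Qed.

Lemma unique_longest_ext (X Y : seq nat -> Prop) :
  (forall t, X t <-> Y t) -> unique_longest X <-> unique_longest Y.
Proof.
by move=> XY; split=> -[A /XY hA maxA]; exists A => // B /XY; apply: maxA.
Qed.

(** Lengths add up under concatenation, so a sequence is the unique longest of a
    product family if and only if each part is so in its own family.  Distinct
    pairs of parts may have the same concatenation: from left to right only one
    part is changed, and concatenation with a fixed part is injective; from right
    to left, distinct concatenations have distinct parts. *)
Lemma unique_longest_cat (X Y : seq nat -> Prop) :
  unique_longest (fun t => exists t1 t2, [/\ t = t1 ++ t2, X t1 & Y t2]) <->
  unique_longest X /\ unique_longest Y.
Proof.
split=> [[_ [A1 [A2 [-> X1 Y2]]] maxA]|[[A1 X1 max1] [A2 Y2 max2]]].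
  split; [exists A1 | exists A2] => // B hB neB.
  - have := maxA (B ++ A2); rewrite !size_cat ltn_add2r; apply; first by exists B, A2.
    move=> E; have szB : size B = size A1.
      by move/(congr1 size): E; rewrite !size_cat => /addIn.
    by move/eqP: E; rewrite eqseq_cat // eqxx andbT => /eqP.
  - have := maxA (A1 ++ B); rewrite !size_cat ltn_add2l; apply; first by exists A1, B.
    by move/eqP; rewrite eqseq_cat // eqxx => /eqP.
exists (A1 ++ A2); first by exists A1, A2.
move=> _ [B1 [B2 [-> XB YB]]]; rewrite !size_cat.
have [->|/eqP ne1] := eqVneq B1 A1.
  by have [->//|/eqP ne2 _] := eqVneq B2 A2; rewrite ltn_add2l max2.
move=> _; have lt1 := max1 _ XB ne1.
have [->|/eqP ne2] := eqVneq B2 A2; first by rewrite ltn_add2r.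
by have := max2 _ YB ne2; lia.
Qed.

(** * Cutting a word at its maximum *)

Section Split.

Variables (L R : seq nat) (n : nat).
Hypothesis ltLR : forall x y, x \in L -> y \in R -> x < y.
Hypothesis ltLn : forall x, x \in L -> x < n.
Hypothesis ltRn : forall x, x \in R -> x < n.
Hypothesis uniqR : uniq R.

(** A pattern 231 whose 2 lies in L has its 1 in L as well, all later entries
    being larger, so it stays inside L; and n, being both the first and the
    largest entry of n R, occurs in no pattern 231 of n R. *)
Lemma avoid231_split : avoid231 (L ++ n :: R) <-> avoid231 L /\ avoid231 R.
Proof.
split=> [av|[avL avR] b c a].
  split=> b c a sub; apply: av; apply: subseq_trans sub _.
    exact: prefix_subseq.
  by rewrite -cat_rcons; apply: suffix_subseq.
case/subseq_cat_split=> t1 [t2 [Et sub1 sub2]].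
case: t1 Et sub1 => [|x [|y [|z [|//]]]] Et sub1.
- move: sub2; rewrite /= in Et; rewrite -Et /=; case: eqP => [->|_].
    rewrite -cat1s => sub; apply/negP => /andP[_ lt_nc].
    have := ltRn (mem_subseq sub (mem_head c _)); lia.
  exact: avR.
- case: Et sub1 sub2 => -> <- /mem_subseq inL /mem_subseq inR.
  have := inR a; have := inL x; rewrite !inE !eqxx orbT => /(_ isT) xL /(_ isT).
  by case/orP=> [/eqP->|/(ltLR xL)]; [have := ltLn xL|]; lia.
- case: Et sub1 sub2 => -> -> <- /mem_subseq inL /mem_subseq inR.
  have := inR a; have := inL x; rewrite !inE !eqxx => /(_ isT) xL /(_ isT).
  by case/orP=> [/eqP->|/(ltLR xL)]; [have := ltLn xL|]; lia.
- by case: Et sub1 => -> -> -> _; apply: avL.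
Qed.

Lemma incr_sub_split t : incr_sub (L ++ n :: R) t <->
  exists t1 t2, [/\ t = t1 ++ t2, incr_sub L t1 & t2 = [:: n] \/ incr_sub R t2].
Proof.
split=> [[/subseq_cat_split[t1 [t2 [-> sub1 sub2]]]]|].
  move=> srt; exists t1, t2; split=> //.
    by split=> //; apply: (subseq_sorted ltn_trans (prefix_subseq t1 t2)).
  have srt2 := subseq_sorted ltn_trans (suffix_subseq t1 t2) srt.
  case: t2 sub2 srt2 {srt} => [_ _|x t2]; first by right; rewrite /incr_sub sub0seq.
  rewrite /=; case: eqP => [->|_ sub srt2]; last by right.
  case: t2 => [_ _|y t2 sub /= /andP[lt_ny _]]; first by left.
  by have := ltRn (mem_subseq sub (mem_head y _)); lia.
case=> t1 [t2 [-> [sub1 srt1] h2]].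
have [sub2 srt2] : subseq t2 (n :: R) /\ sorted ltn t2.
  case: h2 => [->|[sub2 srt2]]; first by rewrite sub1seq mem_head.
  by split=> //; apply: subseq_trans sub2 (subseq_cons _ _).
split; first exact: cat_subseq.
rewrite (sorted_pairwise ltn_trans) pairwise_cat -!(sorted_pairwise ltn_trans).
rewrite srt1 srt2 !andbT; apply/allrelP => x y /(mem_subseq sub1) xL.
by move/(mem_subseq sub2); rewrite inE => /orP[/eqP->|/(ltLR xL)//]; apply: ltLn.
Qed.

(** If |R| = 1 then n alone ties with the entry of R.  If |R| >= 2, a unique
    longest sequence, for R or for the larger family, has at least two entries,
    as it has to beat the one-entry sequences, of which there are several. *)
Lemma unique_longest_right :
  unique_longest (fun t => t = [:: n] \/ incr_sub R t) <->
  unique_longest (incr_sub R) /\ size R != 1.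
Proof.
have inc1 x : x \in R -> incr_sub R [:: x] by rewrite /incr_sub sub1seq.
have nR : n \notin R by apply/negP => /ltRn; rewrite ltnn.
split=> [[A hA maxA]|[[A hA maxA] szR]].
  case ER: R => [|r R'].
    split=> //; exists [::]; first by split.
    by move=> B [/=]; case: B.
  have rR : r \in R by rewrite ER mem_head.
  (* A single entry of R is as long as n alone, so A is not n alone and beats it. *)
  have lt1A : 1 < size A.
    have neA : A <> [:: n].
      move=> EA; have ne : [:: r] <> A by rewrite EA => -[Er]; rewrite -Er rR in nR.
      by have := maxA _ (or_intror (inc1 _ rR)) ne; rewrite EA.
    by apply: (maxA _ (or_introl erefl)) => /esym.
  case: hA => [EA|hA]; first by rewrite EA in lt1A.
  rewrite -ER; split; first by exists A => // B hB; apply: maxA; right.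
  by have [/size_subseq szA _] := hA; rewrite neq_ltn (leq_trans lt1A szA) orbT.
case ER: R => [|r R'].
  exists [:: n]; first by left.
  by move=> B [->//|[/=]]; case: B.
rewrite -ER; exists A; first by right.
suff lt1A : 1 < size A by move=> B [-> //|]; apply: maxA.
case: R' ER => [ER|r' R' ER]; first by rewrite ER in szR.
have rR : r \in R by rewrite ER mem_head.
have r'R : r' \in R by rewrite ER !inE eqxx orbT.
have ne_rr' : r != r' by move: uniqR; rewrite ER /= inE negb_or -andbA => /and3P[].
(* Were A shorter, r or r' alone would be at least as long and differ from A. *)
have [Er|/eqP neA] := eqVneq [:: r] A.
  have ne : [:: r'] <> A by rewrite -Er => -[/esym/eqP]; rewrite (negPf ne_rr').
  by have := maxA _ (inc1 _ r'R) ne; rewrite -Er.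
by have := maxA _ (inc1 _ rR) neA.
Qed.

Lemma good_split : good (L ++ n :: R) <-> [/\ good L, good R & size R != 1].
Proof.
have ul := iff_trans (unique_longest_ext incr_sub_split)
  (unique_longest_cat (incr_sub L) (fun t => t = [:: n] \/ incr_sub R t)).
split=> [[/avoid231_split[avL avR] /ul[ulL /unique_longest_right[ulR szR]]] //|].
case=> -[avL ulL] [avR ulR] szR; split; first exact/avoid231_split.
by apply/ul; split=> //; apply/unique_longest_right.
Qed.

End Split.

(** * The recurrence *)

Lemma good_shift m s : good (map (addn m) s) <-> good s.
Proof.
have incE t : incr_sub (map (addn m) s) t <->
    exists2 u, incr_sub s u & t = map (addn m) u.
  have srtE u : sorted ltn (map (addn m) u) = sorted ltn u.
    by rewrite sorted_map; apply: eq_sorted => x y /=; rewrite ltn_add2l.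
  split=> [[/subseq_map_split[u sub ->]]|[u [sub srt] ->]].
    by rewrite srtE; exists u.
  by split; rewrite ?srtE //; apply: map_subseq.
split=> -[av [A hA maxA]]; split.
- move=> b c a /(map_subseq (addn m))/av; lia.
- move/incE: hA maxA => [u hu ->] maxA; exists u => // B hB neB.
  have := maxA (map (addn m) B); rewrite !size_map; apply; first by apply/incE; exists B.
  by move/(inj_map (@addnI m)).
- by move=> b c a /subseq_map_split[[|x [|y [|z [|//]]]] // /av h [-> -> ->]]; lia.
- exists (map (addn m) A); first by apply/incE; exists A.
  move=> _ /incE[u hu ->] ne; rewrite !size_map; apply: maxA => // Eu.
  by apply: ne; rewrite Eu.
Qed.

Lemma mem_good_perms m n s :
  s \in good_perms m n <-> perm_eq s (iota m n) /\ good s.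
Proof.
rewrite mem_filter mem_permutations; split=> [/andP[/asboolP]|[-> /asboolP->]//].
by [].
Qed.

Lemma size_good_perms m n : size (good_perms m n) = size (good_perms 0 n).
Proof.
rewrite -(size_map (map (addn m)) (good_perms 0 n)); apply/perm_size/uniq_perm.
- exact/filter_uniq/permutations_uniq.
- rewrite map_inj_uniq; first exact/filter_uniq/permutations_uniq.
  exact/inj_map/addnI.
move=> s; apply/idP/mapP => [/mem_good_perms[ps gs]|[t /mem_good_perms[pt gt] ->]].
  have Es : s = map (addn m) (map (subn^~ m) s).
    rewrite -map_comp -[LHS]map_id; apply/eq_in_map => x /=.
    by rewrite (perm_mem ps) mem_iota => /andP[? _]; rewrite subnKC.
  exists (map (subn^~ m) s) => //; apply/mem_good_perms.
  rewrite -(good_shift m) -Es; split=> //.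
  apply: (perm_map_inj (@addnI m)).
  by rewrite -Es -iotaDl addn0.
apply/mem_good_perms; rewrite good_shift; split=> //.
by rewrite -[m in iota m]addn0 iotaDl perm_map.
Qed.

(** Sorting L and R separately gives a sorted arrangement of 0, ..., n - 1, hence
    the interval itself, cut after |L| entries. *)
Lemma perm_iota_split (L R : seq nat) n :
  (forall x y, x \in L -> y \in R -> x < y) -> perm_eq (L ++ R) (iota 0 n) ->
  [/\ size L <= n, perm_eq L (iota 0 (size L)) &
      perm_eq R (iota (size L) (n - size L))].
Proof.
move=> ltLR pLR; have szLR := perm_size pLR; rewrite size_cat size_iota in szLR.
have le_Ln : size L <= n by rewrite -szLR leq_addr.
have E : sort leq L ++ sort leq R = iota 0 n.
  apply: (sorted_eq leq_trans anti_leq); last first.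
  - by rewrite (perm_trans _ pLR) // perm_cat // perm_sort.
  - exact: iota_sorted.
  rewrite (sorted_pairwise leq_trans) pairwise_cat -!(sorted_pairwise leq_trans).
  rewrite !sort_sorted ?andbT; try exact: leq_total.
  by apply/allrelP => x y; rewrite !mem_sort => xL yR; apply/ltnW/ltLR.
rewrite -{1}(subnKC le_Ln) iotaD add0n in E.
move/eqP: E; rewrite eqseq_cat ?size_sort ?size_iota // => /andP[/eqP EL /eqP ER].
by split=> //; [rewrite -{1}EL|rewrite -{1}ER]; rewrite perm_sym perm_sort.
Qed.

Lemma good_perms_decomp n s : s \in good_perms 0 n.+1 <->
  exists k, [/\ k < n.+1, n - k != 1 & exists L R,
    [/\ s = L ++ n :: R, L \in good_perms 0 k & R \in good_perms k (n - k)]].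
Proof.
split=> [/mem_good_perms[ps gs]|].
  have uniq_s : uniq s by rewrite (perm_uniq ps) iota_uniq.
  have : n \in s by rewrite (perm_mem ps) mem_iota /=.
  move=> ns; case/splitPr: ns ps gs uniq_s => L R ps gs uniq_s.
  have pLR : perm_eq (L ++ R) (iota 0 n).
    rewrite -(perm_cons n); apply: (@perm_trans _ (L ++ n :: R)).
      by rewrite perm_sym perm_catC /= perm_cons perm_catC.
    by rewrite (perm_trans ps) // -addn1 iotaD add0n perm_catC.
  have lt_n x : x \in L ++ R -> x < n by rewrite (perm_mem pLR) mem_iota.
  have ltLn x : x \in L -> x < n by move=> xL; apply: lt_n; rewrite mem_cat xL.
  have ltRn x : x \in R -> x < n by move=> xR; apply: lt_n; rewrite mem_cat xR orbT.
  have ltLR x y : x \in L -> y \in R -> x < y.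
    move=> xL yR; case: (ltngtP x y) => // [lt_yx|Exy].
      have sub : subseq [:: x; n; y] (L ++ n :: R).
        rewrite -cat1s; apply: cat_subseq; first by rewrite sub1seq.
        by rewrite /= eqxx sub1seq.
      by have := gs.1 _ _ _ sub; rewrite lt_yx ltLn.
    move: uniq_s; rewrite cat_uniq => /and3P[_ /negP[]].
    by apply/hasP; exists y; rewrite ?inE ?yR ?orbT //= -Exy.
  have [leL pL pR] := perm_iota_split ltLR pLR.
  have uniqR : uniq R by rewrite (perm_uniq pR) iota_uniq.
  have [gL gR szR] := (good_split ltLR ltLn ltRn uniqR).1 gs.
  exists (size L); split; rewrite ?ltnS //.
    by rewrite (perm_size pR) size_iota in szR.
  by exists L, R; split=> //; apply/mem_good_perms.
case=> k [lt_kn nk1 [L [R [-> /mem_good_perms[pL gL] /mem_good_perms[pR gR]]]]].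
have inL x : x \in L = (x < k) by rewrite (perm_mem pL) mem_iota.
have inR x : x \in R = (k <= x < n).
  by rewrite (perm_mem pR) mem_iota subnKC.
apply/mem_good_perms; split.
  have -> : iota 0 n.+1 = iota 0 k ++ iota k (n - k) ++ [:: n].
    by rewrite catA -[k in iota k _]add0n -iotaD subnKC // -addn1 iotaD.
  by rewrite perm_cat // -cat1s perm_catC perm_cat.
apply/good_split.
- by move=> x y; rewrite inL inR ; lia.
- by move=> x; rewrite inL; lia.
- by move=> x; rewrite inR => /andP[].
- by rewrite (perm_uniq pR) iota_uniq.
- by split; rewrite ?(perm_size pR) ?size_iota.
Qed.

Definition gcount n := size (good_perms 0 n).

(** The factor n - k = 1 is left out because R must not have exactly one entry. *)
Lemma gcountS n :
  gcount n.+1 = \sum_(k < n.+1 | n - k != 1) gcount k * gcount (n - k).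
Proof.
pose pieces k := [seq L ++ n :: R | L <- good_perms 0 k, R <- good_perms k (n - k)].
pose ks := [seq k <- iota 0 n.+1 | n - k != 1].
have uG m j : uniq (good_perms m j) by exact/filter_uniq/permutations_uniq.
have szL k L : L \in good_perms 0 k -> size L = k.
  by case/mem_good_perms=> /perm_size->; rewrite size_iota.
(* The position of the maximum recovers k, so the pieces are disjoint. *)
have idxn k s : k \in ks -> s \in pieces k -> index n s = k.
  rewrite mem_filter mem_iota => /and3P[_ _ lt_k] /allpairsP[[L R] [/= hL _ ->]].
  have [pL _] := (mem_good_perms _ _ _).1 hL.
  rewrite index_cat (perm_mem pL) mem_iota /= ltnNge -ltnS lt_k /=.
  by rewrite eqxx addn0 (szL k).
transitivity (size [seq s | k <- ks, s <- pieces k]).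
  apply/perm_size/uniq_perm; first exact: uG.
    apply: allpairs_uniq_dep; first by rewrite filter_uniq ?iota_uniq.
      move=> k _; apply: allpairs_uniq; try exact: uG.
      move=> [L R] [L' R'] /allpairsP[[? ?] [/= /szL h1 _ [-> ->]]].
      case/allpairsP=> [[? ?] [/= /szL h2 _ [-> ->]]] /eqP.
      by rewrite eqseq_cat ?h1 ?h2 // eqseq_cons eqxx => /andP[/eqP-> /eqP->].
    move=> _ _ /allpairsPdep[k [s [hk sk ->]]] /allpairsPdep[j [t [hj tj ->]]] /= Est.
    by rewrite -Est in tj *; rewrite -(idxn _ _ hk sk) (idxn _ _ hj tj).
  move=> s; apply/idP/allpairsPdep => [/good_perms_decomp|].
    case=> k [lt_k nk1 [L [R [-> hL hR]]]]; exists k, (L ++ n :: R); split=> //.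
      by rewrite mem_filter nk1 mem_iota.
    by apply: allpairs_f.
  case=> k [_ [+ /allpairsP[[L R] [hL hR ->]] ->]].
  rewrite mem_filter mem_iota => /andP[nk1 lt_k]; apply/good_perms_decomp.
  by exists k; split=> //; exists L, R.
rewrite size_allpairs_dep sumnE big_map big_filter.
rewrite -(big_mkord (fun k => n - k != 1) (fun k => gcount k * gcount (n - k))).
rewrite /index_iota subn0.
by apply: eq_bigr => k _; rewrite size_allpairs size_good_perms.
Qed.

(** * From permutations to words *)

Definition word n (p : 'S_n) : seq nat := [seq val (p i) | i <- enum 'I_n].

Definition ltord n : rel 'I_n := fun i j => i < j.

Lemma ltord_trans n : transitive (@ltord n).
Proof. by move=> j i k; apply: ltn_trans. Qed.

(** Through this, subsequences of [word p] are images of increasing sequences of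
    positions, and hence of sets of positions. *)
Lemma subseq_enum_ord n (u : seq 'I_n) :
  subseq u (enum 'I_n) = sorted (@ltord n) u.
Proof.
have srt : sorted (@ltord n) (enum 'I_n).
  have := iota_ltn_sorted 0 n; rewrite -val_enum_ord sorted_map.
  by [].
apply/idP/idP => [sub|srtu]; first exact: (subseq_sorted (@ltord_trans n) sub srt).
suff -> : u = filter (mem u) (enum 'I_n) by apply: filter_subseq.
apply: (irr_sorted_eq (@ltord_trans n)) => //.
- by move=> i; rewrite /ltord ltnn.
- by apply: sorted_filter => //; apply: ltord_trans.
by move=> i; rewrite mem_filter mem_enum andbT.
Qed.

Lemma p231_val (r : 'I_3) : p231 r = nth 0 [:: 1; 2; 0] r :> nat.
Proof.
have [E0 E1 E2] := p231E.
have ordE k (lt_k : k < 3) : Ordinal lt_k = inord k.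
  by apply: val_inj; rewrite /= inordK.
by case: r => [[|[|[|//]]] lt_r]; rewrite /= ordE.
Qed.

Lemma avoids_word n (p : 'S_n) : avoids p p231 <-> avoid231 (word p).
Proof.
split=> [/negP avp b c a|avw].
  case/subseq_map_split=> -[|i [|j [|k [|//]]]] //; rewrite subseq_enum_ord.
  move=> /= /and3P[ij jk _] [-> -> ->]; apply/negP => /andP[ki kj]; apply: avp.
  apply/existsP; exists [ffun r : 'I_3 => nth i [:: i; j; k] r].
  rewrite /ltord in ij jk.
  apply/andP; split; apply/forallP => r; apply/forallP => s; rewrite !ffunE ?p231_val.
    case: r s => [[|[|[|//]]] ?] [[|[|[|//]]] ?] //=; lia.
  case: r s => [[|[|[|//]]] ?] [[|[|[|//]]] ?] //=; apply/eqP; lia.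
apply/negP => /existsP[f /andP[/forallP incf /forallP patf]].
pose o k : 'I_3 := inord k.
have incf' (r s : 'I_3) : r < s -> f r < f s by have /forallP/(_ s)/implyP := incf r; apply.
have patf' (r s : 'I_3) : (p (f r) < p (f s)) = (p231 r < p231 s).
  by have /forallP/(_ s)/eqP := patf r.
have sub : subseq [:: val (p (f (o 0))); val (p (f (o 1))); val (p (f (o 2)))] (word p).
  apply: (@map_subseq _ _ (fun i => val (p i)) [:: f (o 0); f (o 1); f (o 2)]).
  by rewrite subseq_enum_ord /= /ltord !incf' // !inordK.
have := avw _ _ _ sub; rewrite !patf' !p231_val !inordK //.
Qed.

Definition entries n (p : 'S_n) (A : {set 'I_n}) : seq nat :=
  [seq val (p i) | i <- enum A].

Lemma entries_inj n (p : 'S_n) : injective (entries p).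
Proof.
move=> A B; have inj_p : injective (fun i => val (p i)).
  by move=> i j /val_inj/perm_inj.
by move/(inj_map inj_p) => E; apply/setP => i; rewrite -mem_enum E mem_enum.
Qed.

Lemma size_entries n (p : 'S_n) A : size (entries p A) = #|A|.
Proof. by rewrite size_map cardE. Qed.

Lemma subseq_enum_set n (A : {set 'I_n}) : subseq (enum A) (enum 'I_n).
Proof. by rewrite [enum A]/(filter _ _) -enumT filter_subseq. Qed.

(** [enum A] lists the positions in increasing order, so the condition on pairs
    of positions i < j is the one on the order of occurrence. *)
Lemma sorted_entries n (p : 'S_n) A : sorted ltn (entries p A) = increasing p A.
Proof.
have srt : sorted (@ltord n) (enum A) by rewrite -subseq_enum_ord subseq_enum_set.
apply/idP/idP => [|/forall_inP incA].
  rewrite sorted_map => srtp; apply/forall_inP => i iA; apply/forall_inP => j jA.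
  apply/implyP => lt_ij.
  have ptrans : transitive (relpre (fun i : 'I_n => val (p i)) ltn).
    by move=> y x z; apply: ltn_trans.
  apply: (sorted_ltn_index ptrans srtp); rewrite ?mem_enum //.
  case: (ltngtP (index i (enum A)) (index j (enum A))) => // [lt_ji|Eij].
    have := sorted_ltn_index (@ltord_trans n) srt; move=> /(_ j i).
    by rewrite !mem_enum => /(_ jA iA lt_ji); rewrite /ltord ltnNge (ltnW lt_ij).
  have Eq : i = j by apply: (index_inj i _ _ Eij); rewrite mem_enum.
  by rewrite Eq ltnn in lt_ij.
rewrite sorted_map; apply: (@sub_in_sorted _ (mem A) _ _ _ _ _ srt).
  by move=> i j iA jA; have /forall_inP/(_ j jA)/implyP := incA i iA.
by apply/allP => i; rewrite mem_enum.
Qed.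

Lemma incr_sub_word n (p : 'S_n) t :
  incr_sub (word p) t <-> exists2 A, increasing p A & t = entries p A.
Proof.
split=> [[/subseq_map_split[u sub ->] srt]|[A incA ->]]; last first.
  by split; [apply/map_subseq/subseq_enum_set|rewrite sorted_entries].
have Eu : u = enum [set i in u].
  rewrite [RHS](_ : _ = filter (mem u) (enum 'I_n)).
    by apply/subseq_uniqP => //; apply: enum_uniq.
  rewrite [LHS]/(filter _ _) -enumT; apply: eq_filter => i; exact: in_set.
have Et : [seq val (p i) | i <- u] = entries p [set i in u] by rewrite /entries -Eu.
by exists [set i in u]; rewrite // -sorted_entries -Et.
Qed.

Lemma has_ULIS_word n (p : 'S_n) :
  has_ULIS p <-> unique_longest (incr_sub (word p)).
Proof.
split=> [/existsP[A /andP[incA /forallP maxA]]|[_ /incr_sub_word[A incA ->] maxA]].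
  exists (entries p A); first by apply/incr_sub_word; exists A.
  move=> _ /incr_sub_word[B incB ->] neBA; rewrite !size_entries.
  apply: (implyP (implyP (maxA B) incB)); apply/eqP => EBA; apply: neBA.
  by rewrite EBA.
apply/existsP; exists A; rewrite incA; apply/forallP => B.
apply/implyP => incB; apply/implyP => /eqP neBA; rewrite -!(size_entries p).
by apply: maxA; [apply/incr_sub_word; exists B | move/entries_inj].
Qed.

Lemma perm_word n (p : 'S_n) : perm_eq (word p) (iota 0 n).
Proof.
rewrite -val_enum_ord /word (map_comp val p) perm_map //; apply: uniq_perm.
- by rewrite map_inj_uniq ?enum_uniq //; apply: perm_inj.
- exact: enum_uniq.
move=> i; rewrite mem_enum; apply/mapP; exists (p^-1%g i); rewrite ?mem_enum //.
by rewrite permKV.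
Qed.

Lemma word_inj n : injective (@word n).
Proof.
move=> p q /eq_in_map E; apply/permP => i; apply/val_inj/E; exact: mem_enum.
Qed.

Lemma word_surj n (t : seq nat) : perm_eq t (iota 0 n) -> exists p : 'S_n, t = word p.
Proof.
move=> pt; have szt : size t = n by rewrite (perm_size pt) size_iota.
have lt_nth (i : 'I_n) : nth 0 t i < n.
  have : nth 0 t i \in t by rewrite mem_nth ?szt.
  by rewrite (perm_mem pt) mem_iota.
have inj_t : injective (fun i => Ordinal (lt_nth i)).
  move=> i j [] /eqP; rewrite nth_uniq ?szt ?(perm_uniq pt) ?iota_uniq //.
  by move/eqP/val_inj.
exists (perm inj_t); apply: (@eq_from_nth _ 0).
  by rewrite szt size_map size_enum_ord.
move=> i; rewrite szt => lt_i; rewrite (nth_map (Ordinal lt_i)) ?size_enum_ord //.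
by rewrite permE /= nth_enum_ord.
Qed.

Lemma gcount0 : gcount 0 = 1.
Proof.
rewrite /gcount /good_perms /=; case: asboolP => // -[].
split=> [b c a|] //; exists [::]; first by [].
by move=> B [/=]; case: B.
Qed.

Lemma ulis_count_gcount n : ulis_count n p231 = gcount n.
Proof.
case: n => [|n]; first by rewrite gcount0.
rewrite /ulis_count cardE -(size_map (@word _)); apply/perm_size/uniq_perm.
- by rewrite map_inj_uniq ?enum_uniq //; apply: word_inj.
- exact/filter_uniq/permutations_uniq.
have goodE (p : 'S_n.+1) : avoids p p231 && has_ULIS p <-> good (word p).
  split=> [/andP[/avoids_word ? /has_ULIS_word] //|[/avoids_word-> /has_ULIS_word->] //].
move=> t; apply/mapP/idP => [[p + ->]|/mem_good_perms[/word_surj[p ->] /goodE gp]].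
  by rewrite mem_enum inE => /goodE gp; apply/mem_good_perms; rewrite perm_word.
by exists p; rewrite // mem_enum inE.
Qed.

(** * The generating function *)

Local Open Scope ring_scope.

Lemma fpsX_mulS (R : comNzRingType) (f : fps R) n : (fpsX R * f) n.+1 = f n.
Proof.
rewrite fps_coefM big_ord_recl /= mul0r add0r big_ord_recl /= mul1r subSS subn0.
by rewrite big1 ?addr0 // => i _; rewrite mul0r.
Qed.

(** Subtracting z from u erases the coefficient u(1) = 1, which is what the
    restriction n - k <> 1 in the recurrence does to the second factor. *)
Lemma ulis_gf_eq (u := ulis_gf p231) (z := fpsX rat) : u = 1 + z * (u * (u - z)).
Proof.
have uE n : u n = (gcount n)%:R by rewrite /u /= ulis_count_gcount.
have g1 : gcount 1 = 1%N by rewrite gcountS big_mkcond big_ord1 /= gcount0.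
have uzE n : (u - z) n = if n != 1%N then (gcount n)%:R else 0.
  rewrite fps_coefD fps_coefN uE /=; case: eqP => [->|_] /=; last by rewrite subr0.
  by rewrite g1 subrr.
apply: fpsP => -[|n]; rewrite [LHS]uE fps_coefD fps_coef1.
  by rewrite gcount0 fps_coefM big_ord1 mul0r addr0.
rewrite fpsX_mulS add0r gcountS fps_coefM big_mkcond natr_sum.
apply: eq_bigr => k _; rewrite uE uzE; case: ifP => _; first by rewrite natrM.
by rewrite mulr0.
Qed.

(* The quotient is taken in the fraction field of the ring of power series,   *)
(* as 2z is not invertible there.                                             *)
Theorem mainTheorem1 :
  let z : fps rat := fpsX rat in
  tofrac (ulis_gf p231) =
    tofrac (1 + z ^+ 2 - fps_sqrt (1 - 4 * z + 2 * z ^+ 2 + z ^+ 4))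
      / tofrac (2 * z).
Proof.
move=> z; have := ulis_gf_eq; rewrite -/z; set u := ulis_gf p231 => uE.
have -> : fps_sqrt (1 - 4 * z + 2 * z ^+ 2 + z ^+ 4) = 1 + z ^+ 2 - 2 * z * u.
  apply: fps_sqrt_uniq => //.
    rewrite -mulrA mulrCA expr2 fps_coefD fps_coefN fps_coefD.
    by rewrite !fps_coefM !big_ord1 /= !mul0r subr0 addr0.
  (* Arranged so that the right-hand side of the functional equation for u occurs. *)
  have -> : (1 + z ^+ 2 - 2 * z * u) ^+ 2 =
      (1 + z ^+ 2) ^+ 2 - 4 * z * (u - z * (u * (u - z))) by ring.
  by rewrite {1}uE addrK; ring.
have z2_neq0 : 2 * z != 0.
  apply/eqP => /(congr1 (fun f : fps rat => f 1%N)).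
  by rewrite mulrC fpsX_mulS.
have -> : 1 + z ^+ 2 - (1 + z ^+ 2 - 2 * z * u) = u * (2 * z) by ring.
by rewrite tofracM mulfK // tofrac_eq0.
Qed.
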